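(* Let $\alpha\in(0,1)$, let $\ell\ge1/\alpha$ be an integer with $\alpha\ell\in\mathbb N$, and let $n\ge\ell$. Let $C=C_{n,\ell,\alpha}$, $\pi$ the uniform distribution on $[n]^\ell$ and $L=I-C$. For every positive integer $r\le\ell/2$, there is a degree-2 sum-of-squares proof, in the formal variables $(F(X))_{X\in[n]^\ell}$ and from the axioms $\{0\le F(X)\le1\}_{X}\cup\mathcal{A}_{inv}$, of $$\langle F,LF\rangle_\pi\ \ge\ \big(1-(1-\alpha)^{r+1}\big)\Big[\mathbb{E}_\pi[F]-8^r\binom{\ell}{r}\sum_{j=0}^r\mathbb{E}_{Y\in[n]^j}\big[\delta_Y(F)^2\big]+\mathbb{E}_\pi[F^2-F]\Big].$$ In particular this holds for every permutation-invariant $F:[n]^\ell\to[0,1]$.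
   Context: Johnson-approximating graph $C_{n,\ell,\alpha}$ (for $\alpha\in(0,1)$, $\alpha\ell\in\mathbb N$, $n>\ell$): vertex set $[n]^\ell=(\mathbb Z/n\mathbb Z)^\ell$; a random neighbor of $X=(x_1,\dots,x_\ell)$ is $(x_1+b_1y_1,\dots,x_\ell+b_\ell y_\ell)$ where $y$ is uniform in $[n]^\ell$ and $b$ is uniform among vectors in $\{0,1\}^\ell$ of Hamming weight $\alpha\ell$; $C$ also denotes the corresponding transition (normalized adjacency) matrix. $\langle f,g\rangle_\pi=\mathbb{E}_{X\sim\pi}f(X)g(X)$. $F$ is permutation-invariant if $F(x_1,\dots,x_\ell)=F(x_{\sigma(1)},\dots,x_{\sigma(\ell)})$ for all $\sigma\in S_\ell$; $\mathcal{A}_{inv}$ is the set of these equalities. For $Y\in[n]^j$ ($0\le j\le\ell-1$), the restriction $F|_Y:[n]^{\ell-j}\to\mathbb R$ is $F|_Y(x)=F(Y,x)$ and $\delta_Y(F)=\mathbb{E}_{x\in[n]^{\ell-j}}F|_Y(x)$; for $j=0$, $\delta_\emptyset(F)=\mathbb{E}_\pi[F]$. A degree-$d$ SoS proof from axioms means the difference is a sum of squares plus combinations of the inequality axioms with SoS multipliers and of the equality axioms with arbitrary multipliers, all of degree $\le d$. *)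

(* Defs.v *)
From HB Require Import structures.
From mathcomp Require Import all_boot all_order all_algebra all_fingroup.
From mathcomp Require Import reals.
From mathcomp Require Import mpoly.
Set Implicit Arguments. Unset Strict Implicit. Unset Printing Implicit Defensive.
Import Order.TTheory GRing.Theory Num.Theory.
Local Open Scope ring_scope.

Section SoS.
Variables (R : realFieldType) (m : nat).
Local Notation P := {mpoly R[m]}.

Definition is_sos (d : nat) (p : P) : Prop :=
  exists l : seq P, p = \sum_(q <- l) q ^+ 2 /\ all (fun q => msize (q ^+ 2) <= d.+1)%N l.

Definition sos_proof (d : nat) (I J : finType) (g : I -> P) (e : J -> P) (p : P) : Prop :=
  exists (s0 : P) (s : I -> P) (h : J -> P),
    [/\ is_sos d s0,
        forall i, is_sos d (s i) /\ (msize (s i * g i) <= d.+1)%N,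
        forall j, (msize (h j * e j) <= d.+1)%N &
        p = s0 + \sum_i s i * g i + \sum_j h j * e j].
End SoS.

(* The vertex set [n]^l = (Z/nZ)^l (we assume n >= 2, so 'Z_n is Z/nZ). *)
Definition vtx (n l : nat) := {ffun 'I_l -> 'Z_n}.

(* Weight-k indicator vectors b in {0,1}^l, as subsets of 'I_l. *)
Definition wvec (l k : nat) := [set b : {set 'I_l} | #|b| == k].

Definition step (n l : nat) (X : vtx n l) (b : {set 'I_l}) (y : vtx n l) : vtx n l :=
  [ffun i => X i + (if i \in b then y i else 0)].

(* Transition matrix C_{n,l,alpha} with alpha*l = k:
   C X Z = Pr_{b,y}[ X + b y = Z ]. *)
Definition Cmat (R : realFieldType) (n l k : nat) (X Z : vtx n l) : R :=
  (#|[set p : {set 'I_l} * vtx n l | (p.1 \in wvec l k) && (step X p.1 p.2 == Z)]|%:R)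
  / (#|wvec l k|%:R * #|{: vtx n l}|%:R).

Section Poly.
Variables (R : realFieldType) (n l : nat).
Local Notation V := (vtx n l).
Local Notation P := {mpoly R[#|{: V}|]}.

Definition Fv (X : V) : P := 'X_(enum_rank X).

Definition Eu (T : finType) (f : T -> P) : P :=
  (#|{: T}|%:R)^-1 *: \sum_(t : T) f t.

Definition dirichlet (k : nat) : P :=
  Eu (fun X : V => Fv X * (Fv X - \sum_(Z : V) Cmat R k X Z *: Fv Z)).

Definition catv (j : nat) (Y : vtx n j) (x : vtx n (l - j)) : V :=
  [ffun i : 'I_l =>
     match (insub (val i) : option 'I_j) return 'Z_n with
     | Some i' => Y i'
     | None => match (insub (val i - j)%N : option 'I_(l - j)) return 'Z_n with
               | Some i'' => x i''
               | None => 0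
               end
     end].

Definition delta (j : nat) (Y : vtx n j) : P :=
  Eu (fun x : vtx n (l - j) => Fv (catv Y x)).

Definition permv (s : {perm 'I_l}) (X : V) : V := [ffun i => X (s i)].

Definition box_ax (p : V * bool) : P := if p.2 then Fv p.1 else 1 - Fv p.1.

Definition inv_ax (p : V * {perm 'I_l}) : P := Fv p.1 - Fv (permv p.2 p.1).

Definition rhsC1 (alpha : R) (r : nat) : P :=
  (1 - (1 - alpha) ^+ r.+1) *:
    (Eu Fv - ((8 : R) ^+ r * 'C(l, r)%:R) *:
               (\sum_(j < r.+1) Eu (fun Y : vtx n j => delta Y ^+ 2))
           + Eu (fun X : V => Fv X ^+ 2 - Fv X)).

Definition evalF (f : V -> R) (p : P) : R := p.@[fun i => f (enum_val i)].
End Poly.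

(* Main.v *)
Require Import Defs.
From HB Require Import structures.
From mathcomp Require Import all_boot all_order all_algebra all_fingroup.
From mathcomp Require Import reals.
From mathcomp Require Import mpoly.
From mathcomp Require Import zify ring lra.
Import Order.TTheory GRing.Theory Num.Theory.
Local Open Scope ring_scope.

(** Averaging over the coordinates outside [S] gives commuting projections
    [av S], and [C] is the mean of [av (~: B)] over the sets [B] of size
    [alpha * l]; hence the Dirichlet form is
    [\sum_T (1 - 'C(l - #|T|, k) / 'C(l, k)) * weight T], where [weight T] is
    the squared norm of the [T]-component of the Efron-Stein decomposition and
    the ratio is at most [(1 - alpha) ^+ #|T|].  Each [weight T] is a sum of
    squares and [energy S = \sum_(T \subset S) weight T], so the weights of
    level at most [r] are dominated by [\sum_(#|S| <= r) energy S], which is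
    [\sum_(j <= r) 'C(l, j) * E_Y[delta_Y ^+ 2]] modulo the invariance axioms;
    finally ['C(l, j) <= 'C(l, r)] since [r <= l / 2]. *)

(** * Sum-of-squares proofs *)

Section Degree.
Set Implicit Arguments. Unset Strict Implicit. Unset Printing Implicit Defensive.
Variables (R : idomainType) (m : nat).
Implicit Types p q : {mpoly R[m]}.

Lemma msizeD_leq b p q :
  (msize p <= b)%N -> (msize q <= b)%N -> (msize (p + q) <= b)%N.
Proof.
by move=> pb qb; apply: leq_trans (mmeasureD_le _ p q) _; rewrite geq_max pb.
Qed.

Lemma msize_sum_leq b (T : Type) (s : seq T) (P : pred T) (f : T -> {mpoly R[m]}) :
  (forall t, P t -> (msize (f t) <= b)%N) ->
  (msize (\sum_(t <- s | P t) f t) <= b)%N.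
Proof.
by move=> fb; elim/big_ind: _ => //; [rewrite mmeasure0 | exact: msizeD_leq].
Qed.

(** [msize] is the degree plus one, and 0 for the zero polynomial, so this bounds products of affine
    polynomials by degree 2. The zero cases are split off because [msizeM] needs nonzero factors. *)
Lemma msizeM_leq p q : (msize p <= 2)%N -> (msize q <= 2)%N -> (msize (p * q) <= 3)%N.
Proof.
move=> p2 q2; have [->|p0] := eqVneq p 0; first by rewrite mul0r mmeasure0.
have [->|q0] := eqVneq q 0; first by rewrite mulr0 mmeasure0.
rewrite msizeM //; apply: leq_trans (_ : (2 + 2).-1 <= 3)%N => //.
by rewrite -!subn1 leq_sub2r // leq_add.
Qed.

End Degree.

Section SosClosure.
Set Implicit Arguments. Unset Strict Implicit. Unset Printing Implicit Defensive.
Variables (R : rcfType) (m d : nat).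
Implicit Types p q : {mpoly R[m]}.

Lemma is_sos0 : is_sos d (0 : {mpoly R[m]}).
Proof. by exists [::]; rewrite big_nil. Qed.

Lemma is_sosD p q : is_sos d p -> is_sos d q -> is_sos d (p + q).
Proof.
move=> [s [-> sd]] [t [-> td]]; exists (s ++ t).
by rewrite big_cat all_cat sd td.
Qed.

(** The definition of [is_sos] carries no weights, so the scalar is absorbed as the square of
    [Num.sqrt c]; this is why [R] is real closed here. *)
Lemma is_sosZ (c : R) p : 0 <= c -> is_sos d p -> is_sos d (c *: p).
Proof.
move=> c0 [s [-> /allP sd]]; exists [seq Num.sqrt c *: q | q <- s]; split.
  by rewrite big_map scaler_sumr; apply: eq_bigr => q _; rewrite exprZn sqr_sqrtr.
apply/allP => _ /mapP[q /sd qd ->].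
by rewrite exprZn; apply: leq_trans qd; apply: mmeasureZ_le.
Qed.

Variables (I J : finType) (g : I -> {mpoly R[m]}) (e : J -> {mpoly R[m]}).
Local Notation sos := (sos_proof d g e).

Lemma sos_proof_sos p : is_sos d p -> sos p.
Proof.
move=> sp; exists p, (fun=> 0), (fun=> 0); split=> //.
- by move=> i; rewrite mul0r mmeasure0; split=> //; apply: is_sos0.
- by move=> j; rewrite mul0r mmeasure0.
by rewrite !big1 ?addr0 // => i _; rewrite mul0r.
Qed.

Lemma sos_proof_sqr q : (msize (q ^+ 2) <= d.+1)%N -> sos (q ^+ 2).
Proof.
by move=> qd; apply: sos_proof_sos; exists [:: q]; rewrite big_seq1 /= qd.
Qed.

Lemma sos_proof_eq h j : (msize (h * e j) <= d.+1)%N -> sos (h * e j).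
Proof.
move=> hd; exists 0, (fun=> 0), (fun j' => if j' == j then h else 0); split.
- exact: is_sos0.
- by move=> i; rewrite mul0r mmeasure0; split=> //; apply: is_sos0.
- by move=> j'; case: eqP => [->//|_]; rewrite mul0r mmeasure0.
rewrite [X in 0 + X]big1 => [|i _]; last by rewrite mul0r.
rewrite (bigD1 j) //= eqxx big1 ?addr0 ?add0r // => j' /negbTE->.
by rewrite mul0r.
Qed.

Lemma sos_proofD p q : sos p -> sos q -> sos (p + q).
Proof.
move=> [s0 [s [h [s0d sd hd ->]]]] [t0 [t [k [t0d td kd ->]]]].
exists (s0 + t0), (fun i => s i + t i), (fun j => h j + k j); split.
- exact: is_sosD.
- move=> i; have [[? ?] [? ?]] := (sd i, td i).
  by split; [apply: is_sosD | rewrite mulrDl; apply: msizeD_leq].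
- by move=> j; rewrite mulrDl; apply: msizeD_leq.
under [X in _ = _ + X + _]eq_bigr do rewrite mulrDl.
under [X in _ = _ + X]eq_bigr do rewrite mulrDl.
by rewrite !big_split /= (addrACA s0 t0) [RHS]addrACA.
Qed.

Lemma sos_proofZ (c : R) p : 0 <= c -> sos p -> sos (c *: p).
Proof.
move=> c0 [s0 [s [h [s0d sd hd ->]]]].
exists (c *: s0), (fun i => c *: s i), (fun j => c *: h j); split.
- exact: is_sosZ.
- move=> i; have [? si] := sd i; split; first exact: is_sosZ.
  by rewrite -scalerAl; apply: leq_trans si; apply: mmeasureZ_le.
- by move=> j; rewrite -scalerAl; apply: leq_trans (hd j); apply: mmeasureZ_le.
rewrite !scalerDr !scaler_sumr; congr (_ + _ + _).
  by apply: eq_bigr => i _; rewrite scalerAl.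
by apply: eq_bigr => i _; rewrite scalerAl.
Qed.

Lemma sos_proof_sum (T : Type) (r : seq T) (P : pred T) (f : T -> {mpoly R[m]}) :
  (forall t, P t -> sos (f t)) -> sos (\sum_(t <- r | P t) f t).
Proof.
move=> fS; elim/big_ind: _ => //; last exact: sos_proofD.
exact: sos_proof_sos is_sos0.
Qed.

Lemma sos_proof_sound (v : 'I_m -> R) p :
  (forall i, 0 <= (g i).@[v]) -> (forall j, (e j).@[v] = 0) ->
  sos p -> 0 <= p.@[v].
Proof.
move=> g0 e0 [s0 [s [h [s0d sd _ ->]]]].
have sos_ge0 q : is_sos d q -> 0 <= q.@[v].
  move=> [t [-> _]]; rewrite raddf_sum sumr_ge0 // => i _.
  by rewrite /= expr2 mevalM -expr2 sqr_ge0.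
rewrite !mevalD !raddf_sum; apply: addr_ge0; first apply: addr_ge0.
- exact: sos_ge0.
- apply: sumr_ge0 => i _ /=; rewrite mevalM mulr_ge0 // sos_ge0 //.
  by case: (sd i).
- by rewrite big1 // => j _ /=; rewrite mevalM e0 mulr0.
Qed.

End SosClosure.

(** * Alternating sums over subsets *)

Section Alternating.
Set Implicit Arguments. Unset Strict Implicit. Unset Printing Implicit Defensive.
Variables (R : numFieldType) (I : finType).
Implicit Types (S T U : {set I}).

(** Symmetric difference with the singleton of [i], the sign-reversing involution behind the
    cancellations below. *)
Definition toggle (i : I) T : {set I} := [set x | (x \in T) (+) (x == i)].

Lemma toggleK i : involutive (toggle i).
Proof. by move=> T; apply/setP => x; rewrite !inE -addbA addbb addbF. Qed.

Lemma in_toggle i T x : x != i -> (x \in toggle i T) = (x \in T).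
Proof. by rewrite inE => /negbTE->; rewrite addbF. Qed.

Lemma toggle_subset i T S : i \in S -> (toggle i T \subset S) = (T \subset S).
Proof.
move=> iS; apply/subsetP/subsetP => TS x xT; have [->//|xi] := eqVneq x i.
  by apply: TS; rewrite in_toggle.
by apply: TS; rewrite -(in_toggle _ xi).
Qed.

Lemma sign_card_toggle i T : (-1) ^+ #|toggle i T| = - (-1) ^+ #|T| :> R.
Proof.
(* Deletion of [i] is computed directly; insertion is deletion read backwards through [toggleK]. *)
have D S : i \in S -> (-1) ^+ #|toggle i S| = - (-1) ^+ #|S| :> R.
  move=> iS; rewrite (cardsD1 i S) iS exprS mulN1r opprK; congr (_ ^+ #|pred_of_set _|).
  by apply/setP => x; rewrite !inE; case: eqP => [->|]; rewrite ?iS ?addbF ?addbT.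
have [/D//|iT] := boolP (i \in T).
rewrite -{2}(toggleK i T) (D (toggle i T)) ?opprK //.
by rewrite in_set eqxx addbT iT.
Qed.

(** Reindexing by the involution turns the sum into its own negative, and 2 is nonzero in [R].
    Module values let it serve both for signs and for polynomials. *)
Lemma sum_toggle0 (M : lmodType R) i (f : {set I} -> M) :
  (forall T, f (toggle i T) = - f T) -> \sum_T f T = 0.
Proof.
move=> fN; have E : \sum_T f T = - \sum_T f T.
  rewrite {1}(reindex_inj (inv_inj (toggleK i))) -sumrN.
  by apply: eq_bigr.
have : (2 : R) *: \sum_T f T = 0.
  by rewrite -[2]/(1 + 1) scalerDl scale1r {1}E addNr.
by move/eqP; rewrite scaler_eq0 pnatr_eq0 /= => /eqP.
Qed.

(** Möbius inversion on the Boolean lattice: if [U] is strictly below [S], toggling an element of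
    [S] outside [U] preserves the interval and flips the sign. *)
Lemma alternating_sum_itv U S :
  \sum_(T : {set I} | (U \subset T) && (T \subset S)) (-1) ^+ (#|T| + #|U|)
    = (U == S)%:R :> R.
Proof.
have [->|UneS] := eqVneq U S.
  rewrite (bigD1 S) ?subxx //= exprD -expr2 sqrr_sign big1 ?addr0 // => T.
  by rewrite [X in X && _]andbC -eqEsubset => /andP[->].
have [US|/subsetPn[i iU iS]] := boolP (U \subset S); last first.
  rewrite big1 // => T /andP[UT TS].
  by case/negP: iS; apply: (subsetP TS); apply: (subsetP UT).
have /properP[_ [i iS iU]] : U \proper S by rewrite properEneq UneS.
rewrite big_mkcond; apply: (@sum_toggle0 R^o i) => T /=.
have -> : (U \subset toggle i T) = (U \subset T).
  apply/subsetP/subsetP => UT x xU; have := UT x xU; rewrite in_toggle //;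
  by apply: contraNneq iU => <-.
rewrite toggle_subset //.
by case: ifP; rewrite ?oppr0 // !exprD sign_card_toggle mulNr.
Qed.

End Alternating.

(** * Averaging over coordinates *)

Section Averages.
Set Implicit Arguments. Unset Strict Implicit. Unset Printing Implicit Defensive.
Variables (R : realFieldType) (n l : nat).
Local Notation V := (vtx n l).
Local Notation P := {mpoly R[#|{: V}|]}.

Lemma vtx_card_neq0 j : #|{: vtx n j}|%:R != 0 :> R.
Proof. by rewrite pnatr_eq0 -lt0n; apply/card_gt0P; exists [ffun=> 0]. Qed.

Lemma eq_Eu (T : finType) (f g : T -> P) : f =1 g -> Eu f = Eu g.
Proof. by move=> fg; congr (_ *: _); apply: eq_bigr => t _. Qed.

Lemma EuZ (T : finType) (c : R) (f : T -> P) : Eu (fun t => c *: f t) = c *: Eu f.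
Proof. by rewrite /Eu -scaler_sumr !scalerA mulrC. Qed.

Lemma Eu_sum (T I : finType) (Q : pred I) (f : I -> T -> P) :
  Eu (fun t => \sum_(i | Q i) f i t) = \sum_(i | Q i) Eu (f i).
Proof. by rewrite /Eu exchange_big scaler_sumr. Qed.

Lemma EuD (T : finType) (f g : T -> P) : Eu (fun t => f t + g t) = Eu f + Eu g.
Proof. by rewrite /Eu big_split scalerDr. Qed.

Lemma EuB (T : finType) (f g : T -> P) : Eu (fun t => f t - g t) = Eu f - Eu g.
Proof. by rewrite /Eu sumrB scalerBr. Qed.

Lemma EuMr (T : finType) (q : P) (f : T -> P) : Eu (fun t => q * f t) = q * Eu f.
Proof. by rewrite /Eu -mulr_sumr scalerAr. Qed.

Lemma EuMl (T : finType) (q : P) (f : T -> P) : Eu (fun t => f t * q) = Eu f * q.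
Proof. by rewrite /Eu -mulr_suml scalerAl. Qed.

Lemma Eu_const (T : finType) (q : P) : #|{: T}|%:R != 0 :> R -> Eu (fun _ : T => q) = q.
Proof.
by move=> T0; rewrite /Eu sumr_const -[q *+ _]scaler_nat scalerA mulVf ?scale1r.
Qed.

Lemma Eu_pair (T U : finType) (f : T -> U -> P) :
  Eu (fun t => Eu (f t)) = Eu (fun p : T * U => f p.1 p.2).
Proof.
by rewrite /Eu -scaler_sumr scalerA pair_big card_prod natrM invfM.
Qed.

Lemma exchange_Eu (T U : finType) (f : T -> U -> P) :
  Eu (fun t => Eu (f t)) = Eu (fun u => Eu (f^~ u)).
Proof. by rewrite /Eu -!scaler_sumr exchange_big !scalerA mulrC. Qed.

Lemma reindex_Eu (T U : finType) (h : T -> U) (f : U -> P) :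
  bijective h -> Eu f = Eu (f \o h).
Proof.
move=> hb; rewrite /Eu -(bij_eq_card hb); congr (_ *: _).
by rewrite (reindex h) //; apply: onW_bij.
Qed.

Lemma msize_Eu b (T : finType) (f : T -> P) :
  (forall t, (msize (f t) <= b)%N) -> (msize (Eu f) <= b)%N.
Proof.
move=> fb; apply: leq_trans (mmeasureZ_le _ _ _) _.
by apply: msize_sum_leq.
Qed.

Definition mix (S : {set 'I_l}) (X Y : V) : V :=
  [ffun i => if i \in S then X i else Y i].

(** Two independent uniform points keep their joint law when they exchange their coordinates outside
    [S]. *)
Lemma Eu_mix S (f : V -> V -> P) :
  Eu (fun X => Eu (fun Y => f (mix S X Y) (mix S Y X))) = Eu (fun X => Eu (f X)).
Proof.
rewrite !Eu_pair.
pose swap (p : V * V) := (mix S p.1 p.2, mix S p.2 p.1).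
have swapK : involutive swap.
  by move=> [X Y]; rewrite /swap /=; congr (_, _); apply/ffunP => i; rewrite !ffunE; case: (i \in S).
by rewrite [RHS](reindex_Eu _ (inv_bij swapK)).
Qed.

(* The conditional expectation of [f] given the coordinates in [S]. *)
Definition av (S : {set 'I_l}) (f : V -> P) (X : V) : P := Eu (fun Y => f (mix S X Y)).

(** Only coordinates in both sets survive the two resamplings; the others come from [mix T Y Z],
    which is again uniform by [Eu_mix]. *)
Lemma avI S T (f : V -> P) X : av S (av T f) X = av (S :&: T) f X.
Proof.
rewrite /av exchange_Eu.
transitivity (Eu (fun Z => Eu (fun Y => f (mix (S :&: T) X (mix T Y Z))))).
  apply: eq_Eu => Z; apply: eq_Eu => Y; congr f.
  by apply/ffunP => i; rewrite !ffunE !inE; do 2!case: (i \in _).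
rewrite exchange_Eu (Eu_mix T (fun Y _ => f (mix (S :&: T) X Y))).
by apply: eq_Eu => Y; rewrite Eu_const ?vtx_card_neq0.
Qed.

(** The exchange of [Eu_mix] swaps the points [X] and [mix S X Y]. With [avI], this makes [av S] an
    orthogonal projection. *)
Lemma av_adjoint S (f g : V -> P) :
  Eu (fun X => f X * av S g X) = Eu (fun X => av S f X * g X).
Proof.
under eq_Eu do rewrite -EuMr; under [RHS]eq_Eu do rewrite -EuMl.
rewrite -[RHS](Eu_mix S); apply: eq_Eu => X; apply: eq_Eu => Y.
congr (f _ * _).
by apply/ffunP => i; rewrite !ffunE; case: (i \in S).
Qed.

Lemma avT (f : V -> P) : av setT f =1 f.
Proof.
move=> X; rewrite -[RHS](@Eu_const V) ?vtx_card_neq0 //; apply: eq_Eu => Y.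
by congr f; apply/ffunP => i; rewrite !ffunE inE.
Qed.

Section Levels.
Variable f : V -> P.

(* [energy S] is the squared norm of [av S f]; [level T] is the [T]-component
   of the Efron-Stein decomposition of [f], and [weight T] its squared norm. *)
Definition energy S : P := Eu (fun X => f X * av S f X).

Lemma Eu_avM S T : Eu (fun X => av S f X * av T f X) = energy (S :&: T).
Proof. by rewrite -av_adjoint; apply: eq_Eu => X; rewrite avI. Qed.

Lemma energyE S : energy S = Eu (fun X => av S f X ^+ 2).
Proof. by rewrite -{1}[S]setIid -Eu_avM. Qed.

Lemma energyT : energy setT = Eu (fun X => f X ^+ 2).
Proof. by apply: eq_Eu => X; rewrite avT. Qed.

Definition level (T : {set 'I_l}) (X : V) : P :=
  \sum_(S : {set 'I_l} | S \subset T) (-1) ^+ (#|T| + #|S|) *: av S f X.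

Definition weight T : P := Eu (fun X => level T X ^+ 2).

(** Möbius inversion of the definition of [level]: after exchanging the sums, only the term
    [av S f X] has a nonzero coefficient. *)
Lemma sum_level (S : {set 'I_l}) X : \sum_(T : {set 'I_l} | T \subset S) level T X = av S f X.
Proof.
rewrite (exchange_big_dep xpredT) //=.
under eq_bigr => U _ do
  rewrite -scaler_suml (eq_bigl _ _ (fun T => andbC _ _)) alternating_sum_itv.
rewrite (bigD1 S) //= eqxx scale1r big1 ?addr0 // => U /negbTE->.
by rewrite scale0r.
Qed.

Lemma Eu_av_level U T :
  Eu (fun X => av U f X * level T X)
    = \sum_(S : {set 'I_l} | S \subset T) (-1) ^+ (#|T| + #|S|) *: energy (U :&: S).
Proof.
under eq_Eu do rewrite mulr_sumr.
rewrite Eu_sum; apply: eq_bigr => S _.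
by rewrite -Eu_avM -EuZ; apply: eq_Eu => X; rewrite scalerAr.
Qed.

(** Toggling an element of [T] outside [U] leaves [U :&: S] unchanged and flips the sign, so the
    terms cancel in pairs. *)
Lemma level_orthogonal (U T : {set 'I_l}) : U \proper T ->
  Eu (fun X => av U f X * level T X) = 0.
Proof.
case/properP => _ [i iT iU]; rewrite Eu_av_level big_mkcond.
apply: (@sum_toggle0 R _ _ i) => S; rewrite toggle_subset //.
have -> : U :&: toggle i S = U :&: S.
  apply/setP => x; rewrite !inE; case: eqP => [->|_]; last by rewrite addbF.
  by rewrite (negbTE iU).
by case: ifP; rewrite ?oppr0 // !exprD sign_card_toggle mulrN scaleNr.
Qed.

(** Both sides equal the pairing of [av T f] with [level T]. In the square, the averages over proper
    subsets vanish by orthogonality; on the right, [av S] with [S] inside [T] does not distinguish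
    [f] from [av T f]. *)
Lemma weightE T : weight T = Eu (fun X => f X * level T X).
Proof.
transitivity (Eu (fun X => av T f X * level T X)); last first.
  under eq_Eu do rewrite /level mulr_sumr.
  under [RHS]eq_Eu do rewrite /level mulr_sumr.
  rewrite !Eu_sum; apply: eq_bigr => S /setIidPr TS.
  under eq_Eu do rewrite -scalerAr; under [RHS]eq_Eu do rewrite -scalerAr.
  by rewrite !EuZ Eu_avM TS.
rewrite /weight; under eq_Eu do rewrite expr2 {1}/level mulr_suml.
rewrite Eu_sum (bigD1 T) //= big1 ?addr0 => [|S /andP[ST SneT]].
  by apply: eq_Eu => X; rewrite addnn -muln2 exprM sqrr_sign scale1r.
under eq_Eu do rewrite -scalerAl.
by rewrite EuZ level_orthogonal ?scaler0 // properEneq SneT.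
Qed.

Lemma energy_sum_weight (S : {set 'I_l}) : energy S = \sum_(T : {set 'I_l} | T \subset S) weight T.
Proof.
under eq_bigr do rewrite weightE.
rewrite -Eu_sum; apply: eq_Eu => X.
by rewrite -mulr_sumr sum_level.
Qed.

End Levels.
End Averages.

(** * The chain, the restrictions and the symmetries *)

Section Chain.
Set Implicit Arguments. Unset Strict Implicit. Unset Printing Implicit Defensive.
Variables (R : realFieldType) (n l : nat).
Local Notation V := (vtx n l).
Local Notation P := {mpoly R[#|{: V}|]}.

Lemma sum_Cmat k (f : V -> P) X :
  \sum_Z Cmat R k X Z *: f Z
    = (#|wvec l k|%:R)^-1 *: \sum_(B in wvec l k) av (~: B) f X.
Proof.
transitivity ((#|wvec l k|%:R * #|{: V}|%:R)^-1 *: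
    \sum_(p : {set 'I_l} * V | p.1 \in wvec l k) f (step X p.1 p.2) : P).
  rewrite (partition_big (fun p : {set 'I_l} * V => step X p.1 p.2) xpredT) //=.
  rewrite scaler_sumr; apply: eq_bigr => Z _.
  rewrite /Cmat mulrC -scalerA; congr (_ *: _).
  rewrite scaler_nat -sumr_const; apply: eq_big => [p|p]; first by rewrite inE.
  by rewrite inE => /andP[_ /eqP->].
have -> : \sum_(p : {set 'I_l} * V | p.1 \in wvec l k) f (step X p.1 p.2)
    = \sum_(B in wvec l k) \sum_y f (step X B y).
  by rewrite pair_big_dep; apply: eq_bigl => p; rewrite andbT.
rewrite invfM -scalerA scaler_sumr; congr (_ *: _).
apply: eq_bigr => B _; congr (_ *: _).
(* Translation by [X] preserves the uniform law, so adding noise on [B] amounts to resampling the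
   coordinates in [B]. *)
rewrite [RHS](reindex_inj (addrI X)); apply: eq_bigr => y _; congr f.
by apply/ffunP => i; rewrite !ffunE inE; case: ifP; rewrite ?addr0.
Qed.

(** [energy (~: B)] collects the weights of the sets disjoint from [B], and ['C(l - #|T|, k)] of the
    sets [B] of size [k] avoid [T]. *)
Lemma dirichletE k :
  dirichlet R n l k
    = \sum_(T : {set 'I_l}) (1 - 'C(l - #|T|, k)%:R / 'C(l, k)%:R) *: weight (@Fv R n l) T.
Proof.
have -> : dirichlet R n l k = energy (@Fv R n l) setT
    - (#|wvec l k|%:R)^-1 *: \sum_(B in wvec l k) energy (@Fv R n l) (~: B).
  rewrite energyT /dirichlet; under eq_Eu do rewrite mulrBr sum_Cmat.
  rewrite EuB; congr (_ - _); under eq_Eu do rewrite -scalerAr mulr_sumr.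
  by rewrite EuZ Eu_sum.
rewrite energy_sum_weight (eq_bigl xpredT) => [|T]; last by rewrite subsetT.
under [X in _ - _ *: X]eq_bigr do rewrite energy_sum_weight.
rewrite (exchange_big_dep xpredT) //= scaler_sumr -sumrB.
apply: eq_bigr => T _.
rewrite scalerBl scale1r mulrC -scalerA scaler_nat; congr (_ - _ *: _).
  by rewrite card_draws card_ord.
have -> : (l - #|T|)%N = #|~: T| by rewrite -[in RHS](addKn #|T| #|~: T|) cardsC card_ord.
rewrite -cards_draws -sumr_const.
by apply: eq_bigl => B; rewrite !inE andbC -subsetC.
Qed.

Lemma catv_lshift j (Y : vtx n j) (x : vtx n (l - j)) (i : 'I_l) (ij : (i < j)%N) :
  catv Y x i = Y (Ordinal ij).
Proof. by rewrite ffunE insubT. Qed.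

Lemma catv_rshift j (Y : vtx n j) (x : vtx n (l - j)) (i : 'I_l)
    (ji : (j <= i)%N) (il : (i - j < l - j)%N) :
  catv Y x i = x (Ordinal il).
Proof. by rewrite ffunE insubF ?ltnNge ?ji // insubT. Qed.

Lemma catv_bij j : (j <= l)%N ->
  bijective (fun p : vtx n j * vtx n (l - j) => catv p.1 p.2 : V).
Proof.
move=> jl.
pose lpart (X : V) : vtx n j := [ffun i => X (widen_ord jl i)].
pose rpart (X : V) : vtx n (l - j) := [ffun i => X (cast_ord (subnKC jl) (rshift j i))].
exists (fun X => (lpart X, rpart X)) => [[Y x] | X] /=.
  congr (_, _); apply/ffunP => i; rewrite ffunE.
    rewrite (catv_lshift _ _ (ltn_ord i : (widen_ord jl i < j)%N)).
    by congr (Y _); apply: val_inj.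
  have ji : (j <= cast_ord (subnKC jl) (rshift j i))%N by rewrite /= leq_addr.
  have il : (cast_ord (subnKC jl) (rshift j i) - j < l - j)%N by rewrite /= addKn.
  by rewrite (catv_rshift _ _ ji il); congr (x _); apply: val_inj; rewrite /= addKn.
apply/ffunP => i; case: (ltnP i j) => ij.
  by rewrite (catv_lshift _ _ ij) ffunE; congr (X _); apply: val_inj.
have il : (i - j < l - j)%N by rewrite ltn_sub2r // (leq_ltn_trans ij).
by rewrite (catv_rshift _ _ ij il) ffunE; congr (X _); apply: val_inj; rewrite /= subnKC.
Qed.

Lemma Eu_catv j (f : V -> P) : (j <= l)%N ->
  Eu f = Eu (fun Y : vtx n j => Eu (fun x => f (catv Y x))).
Proof. by move=> jl; rewrite Eu_pair (reindex_Eu _ (catv_bij jl)). Qed.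

Definition prefix_set j : {set 'I_l} := [set i : 'I_l | (i < j)%N].

Lemma mix_catv j (Y Y' : vtx n j) (x x' : vtx n (l - j)) :
  mix (prefix_set j) (catv Y x) (catv Y' x') = catv Y x'.
Proof.
apply/ffunP => i; rewrite ffunE inE; case: (ltnP i j) => ij.
  by rewrite !(catv_lshift _ _ ij).
have il : (i - j < l - j)%N by rewrite ltn_sub2r // (leq_ltn_trans ij).
by rewrite !(catv_rshift _ _ ij il).
Qed.

(** At any point extending [Y], averaging outside the first [j] coordinates returns [delta Y]. Dummy
    averages over [x] and [Y'] bring both sides to the same form. *)
Lemma Eu_delta_sqr j : (j <= l)%N ->
  Eu (fun Y : vtx n j => delta R l Y ^+ 2) = energy (@Fv R n l) (prefix_set j).
Proof.
move=> jl; rewrite energyE (Eu_catv _ jl); apply: eq_Eu => Y.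
rewrite -[LHS](@Eu_const R n l (vtx n (l - j))) ?vtx_card_neq0 //.
apply: eq_Eu => x; congr (_ ^+ 2); rewrite /av (Eu_catv _ jl).
rewrite -[LHS](@Eu_const R n l (vtx n j)) ?vtx_card_neq0 //.
by apply: eq_Eu => Y'; apply: eq_Eu => x'; rewrite mix_catv.
Qed.

Lemma permv_bij (s : {perm 'I_l}) : bijective (@permv n l s).
Proof.
exists (permv s^-1) => X; apply/ffunP => i; rewrite !ffunE; congr (X _).
  exact: permKV.
exact: permK.
Qed.

(** List [T] first and its complement next, and send [i] to the [i]-th entry. *)
Lemma exists_perm_prefix (T : {set 'I_l}) :
  exists s : {perm 'I_l}, forall i, (s i \in T) = (i \in prefix_set #|T|).
Proof.
pose e := enum T ++ enum (~: T).
have size_e : size e = l by rewrite size_cat -!cardE cardsC card_ord.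
have uniq_e : uniq e.
  rewrite cat_uniq !enum_uniq andbT /=; apply/hasPn => i.
  by rewrite !mem_enum inE.
have e_inj : injective (fun i : 'I_l => nth i e i).
  move=> i j; rewrite (set_nth_default j) ?size_e // => /eqP.
  by rewrite nth_uniq ?size_e // => /eqP /val_inj.
exists (perm e_inj) => i; rewrite permE inE nth_cat -cardE.
case: ltnP => iT; first by rewrite -mem_enum mem_nth // -cardE.
apply/negbTE; rewrite -in_setC -mem_enum mem_nth // -cardE.
by rewrite ltn_subLR // cardsC card_ord.
Qed.

Lemma av_permv (T S : {set 'I_l}) (s : {perm 'I_l}) (f : V -> P) X :
  (forall i, (s i \in T) = (i \in S)) ->
  av S f (permv s X) = av T (f \o permv s) X.
Proof.
move=> sT; rewrite /av (reindex_Eu _ (permv_bij s)); apply: eq_Eu => Z /=.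
by congr f; apply/ffunP => i; rewrite !ffunE sT.
Qed.

End Chain.

(** With [m = l - t], passing from [m] to [m - 1] multiplies the binomial by [(m - k) / m], which is
    at most [1 - k / l = 1 - alpha] because [m] is at most [l]. *)
Lemma bin_sub_le (R : realFieldType) (alpha : R) (k l t : nat) :
  0 <= alpha <= 1 -> alpha * l%:R = k%:R -> (0 < k)%N ->
  'C(l - t, k)%:R <= (1 - alpha) ^+ t * 'C(l, k)%:R.
Proof.
move=> /andP[a0 a1] al k0; elim: t => [|t IH]; first by rewrite subn0 mul1r.
have rhs_ge0 : 0 <= (1 - alpha) ^+ t.+1 * 'C(l, k)%:R.
  by rewrite mulr_ge0 ?exprn_ge0 ?subr_ge0.
(* Once the truncated [l - t] reaches 0 it stays there, and ['C(0, k)] vanishes because [k] is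
   positive. *)
rewrite subnS; have [m0|m0] := posnP (l - t); first by rewrite m0 bin_small.
have [mk|km] := ltnP (l - t) k.
  by rewrite bin_small // (leq_ltn_trans (leq_pred _)).
rewrite exprS -mulrA; apply: le_trans (ler_wpM2l _ IH); last by rewrite subr_ge0.
rewrite -(ler_pM2l (_ : 0 < (l - t)%:R)) ?ltr0n // -natrM mul_bin_down natrM mulrA.
apply: ler_wpM2r => //; rewrite natrB // -al mulrBr mulr1 lerB // mulrC.
by rewrite ler_wpM2l // ler_nat leq_subr.
Qed.

(** The ratio of ['C(l, r.+1)] to ['C(l, r)] is [(l - r) / (r + 1)], at least 1 as long as
    [2 * r.+1 <= l]. *)
Lemma leq_bin_half (l j r : nat) : (j <= r)%N -> (2 * r <= l)%N -> ('C(l, j) <= 'C(l, r))%N.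
Proof.
elim: r => [|r IH]; first by rewrite leqn0 => /eqP->.
rewrite leq_eqVlt ltnS => /predU1P[->//|jr] rl.
have r2 : (r.+1 <= l - r)%N by rewrite leq_subRL; [lia|lia].
apply: leq_trans (IH jr _) _; first by lia.
rewrite -(leq_pmul2l (ltn0Sn r)) mul_bin_left.
by rewrite leq_pmul2r // bin_gt0; lia.
Qed.

(** * The sum-of-squares certificate *)

Section JohnsonSos.
Set Implicit Arguments. Unset Strict Implicit. Unset Printing Implicit Defensive.
Variables (R : rcfType) (n l : nat).
Local Notation V := (vtx n l).
Local Notation P := {mpoly R[#|{: V}|]}.
Local Notation sos := (sos_proof 2 (@box_ax R n l) (@inv_ax R n l)).
Local Notation F := (@Fv R n l).

Lemma sos_Eu (T : finType) (f : T -> P) : (forall t, sos (f t)) -> sos (Eu f).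
Proof.
by move=> fS; apply: sos_proofZ; [rewrite invr_ge0 | apply: sos_proof_sum].
Qed.

Lemma msize_Fv X : (msize (F X) <= 2)%N.
Proof. by rewrite msizeX mdeg1. Qed.

Lemma msize_av S X : (msize (av S F X) <= 2)%N.
Proof. by apply: msize_Eu => Y; apply: msize_Fv. Qed.

Lemma sos_weight T : sos (weight F T).
Proof.
apply: sos_Eu => X; apply: sos_proof_sqr; rewrite expr2.
have level2 : (msize (level F T X) <= 2)%N.
  apply: msize_sum_leq => S _; apply: leq_trans (mmeasureZ_le _ _ _) _.
  exact: msize_av.
exact: msizeM_leq.
Qed.

(* A permutation carrying an initial segment onto [T] matches the two averages
   modulo the invariance axioms; the difference of squares is then a linear
   multiple of axioms, which keeps the degree at 2. *)
Lemma sos_energy_prefix (T : {set 'I_l}) :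
  sos (energy F (prefix_set l #|T|) - energy F T).
Proof.
have [s sT] := exists_perm_prefix T.
rewrite !energyE (reindex_Eu _ (permv_bij n s)) -EuB; apply: sos_Eu => X /=.
rewrite subr_sqr (av_permv _ _ sT).
set a := av T F X; set b := av T _ X.
have -> : b - a = Eu (fun Y => - inv_ax R (mix T X Y, s)).
  by rewrite /b /a /av -EuB; apply: eq_Eu => Y; rewrite /inv_ax opprB.
rewrite -EuMl; apply: sos_Eu => Y; rewrite mulNr mulrC -mulNr.
apply: sos_proof_eq; apply: msizeM_leq.
  rewrite mmeasureN; apply: msizeD_leq; last exact: msize_av.
  by apply: msize_Eu => Z; apply: msize_Fv.
by apply: msizeD_leq; rewrite ?mmeasureN msize_Fv.
Qed.

Lemma sum_energy_prefix r :
  \sum_(T : {set 'I_l} | (#|T| <= r)%N) energy F (prefix_set l #|T|)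
    = \sum_(j < r.+1) 'C(l, j)%:R *: energy F (prefix_set l j).
Proof.
(* The filter [#|T| <= r] makes [inord] faithful on the cardinalities. *)
rewrite (partition_big (fun T : {set 'I_l} => inord #|T| : 'I_r.+1) xpredT) //=.
apply: eq_bigr => j _.
have -> : 'C(l, j) = #|[set T : {set 'I_l} | #|T| == j]| by rewrite card_draws card_ord.
rewrite scaler_nat -sumr_const.
apply: eq_big => [T|T /andP[Tr /eqP<-]]; last by rewrite inordK.
rewrite inE; apply/andP/eqP => [[Tr /eqP<-]|Tj]; first by rewrite inordK.
by rewrite Tj -ltnS ltn_ord; split=> //; apply/eqP/val_inj; rewrite /= inordK.
Qed.

Lemma sum_energy r :
  \sum_(S : {set 'I_l} | (#|S| <= r)%N) energy F S
    = \sum_(T : {set 'I_l})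
        #|[set S : {set 'I_l} | (T \subset S) && (#|S| <= r)%N]|%:R *: weight F T.
Proof.
under eq_bigr do rewrite energy_sum_weight.
rewrite (exchange_big_dep xpredT) //=; apply: eq_bigr => T _.
by rewrite scaler_nat -sumr_const; apply: eq_bigl => S; rewrite inE andbC.
Qed.

Lemma sos_dirichlet_sub_rhsC1 (alpha : R) (k r : nat) :
  0 < alpha -> alpha < 1 -> alpha * l%:R = k%:R -> (0 < k)%N -> (2 * r <= l)%N ->
  sos (dirichlet R n l k - rhsC1 n l alpha r).
Proof.
move=> a0 a1 al k0 rl.
pose c := 1 - (1 - alpha) ^+ r.+1.
pose M := (8 : R) ^+ r * 'C(l, r)%:R.
pose N (T : {set 'I_l}) := #|[set S : {set 'I_l} | (T \subset S) && (#|S| <= r)%N]|.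
pose p t : R := 'C(l - t, k)%:R / 'C(l, k)%:R.
have b01 : 0 <= 1 - alpha <= 1 by lra.
have [b0 b1] := andP b01.
have c0 : 0 <= c by rewrite subr_ge0 exprn_ile1.
have c1 : c <= 1 by rewrite gerBl exprn_ge0.
have kl : (k <= l)%N.
  by rewrite -(ler_nat R) -al ler_piMl // ltW.
have pt t : p t <= (1 - alpha) ^+ t.
  rewrite ler_pdivrMr ?ltr0n ?bin_gt0 //; apply: bin_sub_le => //.
  by rewrite !ltW.
(* The term [c * N T] adds all energies of level at most [r]; the second group trades them for
   prefix energies, and the third is the slack left when these, with multiplicity ['C(l, j)], are
   charged against [M]. *)
have -> : dirichlet R n l k - rhsC1 n l alpha r =
  \sum_(T : {set 'I_l}) (1 - p #|T| - c + c * (N T)%:R) *: weight F T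
  + c *: (\sum_(T : {set 'I_l} | (#|T| <= r)%N)
             (energy F (prefix_set l #|T|) - energy F T))
  + c *: (\sum_(j < r.+1) (M - 'C(l, j)%:R) *: energy F (prefix_set l j)).
  rewrite sumrB sum_energy_prefix.
  under [X in _ + c *: X]eq_bigr do rewrite scalerBl.
  rewrite sumrB -[\sum_(_ < _) M *: _]scaler_sumr.
  (* The linear terms cancel: the means of [F] and of [F ^+ 2 - F] add up to the squared norm, which
     is the sum of all weights. *)
  have -> : rhsC1 n l alpha r = c *: (\sum_(T : {set 'I_l}) weight F T
      - M *: \sum_(j < r.+1) energy F (prefix_set l j)).
    rewrite /rhsC1 addrAC -EuD; congr (_ *: (_ - _ *: _)).
      transitivity (energy F setT).
        by rewrite energyT; apply: eq_Eu => X; rewrite addrC subrK.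
      by rewrite energy_sum_weight; apply: eq_bigl => T; rewrite subsetT.
    apply: eq_bigr => j _; rewrite Eu_delta_sqr //.
    by have := ltn_ord j; lia.
  have -> : \sum_(T : {set 'I_l}) (1 - p #|T| - c + c * (N T)%:R) *: weight F T
      = dirichlet R n l k - c *: (\sum_(T : {set 'I_l}) weight F T)
        + c *: (\sum_(S : {set 'I_l} | (#|S| <= r)%N) energy F S).
    rewrite sum_energy dirichletE !scaler_sumr -sumrB -big_split /=.
    apply: eq_bigr => T _; by rewrite (scalerA c _%:R) -scalerBl -scalerDl.
  move: (dirichlet _ _ _ _) (\sum_(T : {set _}) weight F T) => D W.
  move: (\sum_(j < _) energy _ _) (\sum_(j < _) _ *: _) => E A.
  by rewrite -!mul_mpolyC; ring.
apply: sos_proofD; first apply: sos_proofD.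
- apply: sos_proof_sum => T _; apply: sos_proofZ; last exact: sos_weight.
  (* For a low level, [T] is itself counted in [N T], so the coefficient is at least
     [1 - p #|T|]. *)
  have [Tr|rT] := leqP #|T| r.
    have N1 : 1 <= (N T)%:R :> R.
      by rewrite ler1n; apply/card_gt0P; exists T; rewrite inE subxx.
    have : p #|T| <= 1 by apply: le_trans (pt _) _; rewrite exprn_ile1.
    nra.
  (* For a high level, [#|T|] is at least [r.+1], so [p #|T|] is at most
     [(1 - alpha) ^+ r.+1 = 1 - c]. *)
  have : (1 - alpha) ^+ #|T| <= 1 - c.
    by rewrite /c subKr; apply: ler_wiXn2l.
  have := pt #|T|; have : 0 <= c * (N T)%:R by rewrite mulr_ge0.
  lra.
- by apply: sos_proofZ => //; apply: sos_proof_sum => T _; apply: sos_energy_prefix.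
apply: sos_proofZ => //; apply: sos_proof_sum => j _; apply: sos_proofZ.
  (* The chain is ['C(l, j) <= 'C(l, r) <= M], the last step because [8 ^+ r] is at least 1. *)
  rewrite subr_ge0; apply: (@le_trans _ _ 'C(l, r)%:R).
    by rewrite ler_nat leq_bin_half // -ltnS.
  by rewrite ler_peMl // exprn_ege1 // ler1n.
rewrite energyE; apply: sos_Eu => X; apply: sos_proof_sqr.
by rewrite expr2 msizeM_leq ?msize_av.
Qed.

End JohnsonSos.

Theorem theoremC1 (R : realType) (alpha : R) (l k n r : nat) :
  0 < alpha -> alpha < 1 ->
  alpha * l%:R = k%:R ->
  1 <= alpha * l%:R ->
  (l <= n)%N ->
  (0 < r)%N -> (2 * r <= l)%N ->
  sos_proof 2 (@box_ax R n l) (@inv_ax R n l)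
    (@dirichlet R n l k - @rhsC1 R n l alpha r)
  /\ (forall f : vtx n l -> R,
        (forall X, 0 <= f X <= 1) ->
        (forall X (s : {perm 'I_l}), f (permv s X) = f X) ->
        evalF f (@rhsC1 R n l alpha r) <= evalF f (@dirichlet R n l k)).
Proof.
move=> a0 a1 al al1 _ _ rl.
have k0 : (0 < k)%N by rewrite -(ler1n R) -al.
have sosC := @sos_dirichlet_sub_rhsC1 R n l alpha k r a0 a1 al k0 rl.
(* The numerical inequality is soundness of the certificate at the point [f], where the box axioms
   are nonnegative and the invariance axioms vanish. *)
split=> // f f01 finv; rewrite -subr_ge0 -mevalB.
have evalFv X : (Fv R X).@[fun i => f (enum_val i)] = f X.
  by rewrite mevalXU enum_rankK.
apply: sos_proof_sound sosC => [[X []]|[X s]]; have /andP[fX0 fX1] := f01 X.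
- by rewrite /box_ax /= evalFv.
- by rewrite /box_ax /= mevalB meval1 evalFv subr_ge0.
by rewrite /inv_ax mevalB !evalFv /= finv subrr.
Qed.
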